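(* Let $X$ be a real normed linear space, let $p\geq 1$, and let $x,y\in X$ be nonzero vectors with $\|x\|\neq\|y\|$. Then $$\alpha_p[x,y]\leq \|x\|^{p}+\|y\|^{p}-\left(\|x\|+\|y\|-\|x-y\|\right)\left(\min\{\|x\|,\|y\|\}\right)^{p-1}\leq \frac{\|y\|^{p}-\|x\|^{p}}{\|y\|-\|x\|}\,\|x-y\|.$$
   Context: For $p\in\mathbb{R}$ and nonzero vectors $x,y\in X$, the $p$-angular distance is $\alpha_p[x,y]=\big\|\,\|x\|^{p-1}x-\|y\|^{p-1}y\,\big\|$. *)

(* Defs.v *)
From mathcomp Require Import all_boot all_order all_algebra.
From mathcomp Require Import reals exp normedtype.

Set Implicit Arguments.
Unset Strict Implicit.
Unset Printing Implicit Defensive.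

Import Order.TTheory GRing.Theory Num.Theory.
Import numFieldNormedType.Exports.

Local Open Scope ring_scope.

(* The p-angular distance, of interest for nonzero x and y only: powR sends
   base 0 to 0 for every nonzero exponent, negative ones included, and
   0 `^ 0 = 1. *)
Definition angular_dist (R : realType) (X : normedModType R) (p : R)
    (x y : X) : R :=
  `| `|x| `^ (p - 1) *: x - `|y| `^ (p - 1) *: y |.

(* Main.v *)
Require Import Defs.
From mathcomp Require Import all_boot all_order all_algebra.
From mathcomp Require Import reals exp normedtype.
From mathcomp Require Import ring.

Import Order.TTheory GRing.Theory Num.Theory.
Import numFieldNormedType.Exports.

Local Open Scope ring_scope.

(** Everything is symmetric in [x] and [y], so let [a = `|x| < b = `|y|], and
    put [A = a `^ (p - 1)], [B = b `^ (p - 1)], [d = `|x - y|]; then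
    [A <= B] because [1 <= p].  Since [a `^ p = a * A] and [b `^ p = b * B], the
    middle expression collapses to [A * d + (B - A) * b].

    - It bounds the angular distance by the triangle inequality applied to
      [A *: x - B *: y = A *: (x - y) - (B - A) *: y]
      ([norm_scale_sub_le]).
    - Since [(b * B - a * A) / (b - a) = A + b * (B - A) / (b - a)], the
      second inequality compares [(B - A) * b] with [(B - A) * b] times
      [d / (b - a)], and [b - a <= d] by the reverse triangle inequality
      ([weighted_slope_ge]). *)

(** Subtracting the smaller multiple of [x - y] leaves only a multiple of [y]. *)
Lemma norm_scale_sub_le (R : realType) (X : normedModType R) (A B : R)
    (x y : X) : 0 <= A -> A <= B ->
  `|A *: x - B *: y| <= A * `|x - y| + (B - A) * `|y|.
Proof.
move=> A0 AB.
have -> : A *: x - B *: y = A *: (x - y) - (B - A) *: y.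
  by rewrite scalerBr scalerBl opprB addrA subrK.
apply: (le_trans (ler_normB _ _)).
by rewrite !normrZ (ger0_norm A0) ger0_norm ?subr_ge0.
Qed.

(** The difference of the two sides is
    [(B - A) * b * (d - (b - a)) / (b - a)]. *)
Lemma weighted_slope_ge (R : realFieldType) (a b A B d : R) :
  0 <= b -> a < b -> A <= B -> b - a <= d ->
  A * d + (B - A) * b <= (b * B - a * A) / (b - a) * d.
Proof.
move=> b0 ab AB dab.
have ba0 : 0 < b - a by rewrite subr_gt0.
rewrite mulrAC ler_pdivlMr // -subr_ge0.
have -> : (b * B - a * A) * d - (A * d + (B - A) * b) * (b - a)
    = (B - A) * b * (d - (b - a)) by ring.
by rewrite !mulr_ge0 ?subr_ge0.
Qed.

Lemma powR_mulB1 (R : realType) (a p : R) : 0 < a -> a `^ p = a * a `^ (p - 1).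
Proof.
move=> a0; rewrite -{2}(powRr1 (ltW a0)) -powRD; last by rewrite (gt_eqF a0) implybT.
by rewrite addrC subrK.
Qed.

Lemma angular_distC (R : realType) (X : normedModType R) (p : R) (x y : X) :
  angular_dist p x y = angular_dist p y x.
Proof. exact: distrC. Qed.

Theorem theorem4 (R : realType) (X : normedModType R) (p : R) (x y : X)
    (hp : 1 <= p) (hx : x != 0) (hy : y != 0) (hxy : `|x| != `|y|) :
  angular_dist p x y
    <= `|x| `^ p + `|y| `^ p
       - (`|x| + `|y| - `|x - y|) * Num.min `|x| `|y| `^ (p - 1)
  /\
  `|x| `^ p + `|y| `^ p
    - (`|x| + `|y| - `|x - y|) * Num.min `|x| `|y| `^ (p - 1)
    <= (`|y| `^ p - `|x| `^ p) / (`|y| - `|x|) * `|x - y|.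
Proof.
wlog xy : x y hx hy hxy / `|x| < `|y|.
  move=> H; move: (hxy); rewrite neq_lt => /orP[xy|yx]; first exact: H.
  have slopeC : (`|y| `^ p - `|x| `^ p) / (`|y| - `|x|)
      = (`|x| `^ p - `|y| `^ p) / (`|x| - `|y|).
    by rewrite -[LHS]mulrNN -invrN !opprB.
  rewrite slopeC angular_distC (distrC x) minC.
  rewrite (addrC (`|x| `^ p)) (addrC `|x|).
  by apply: H; rewrite // eq_sym.
have a0 : 0 < `|x| by rewrite normr_gt0.
have b0 : 0 < `|y| by rewrite normr_gt0.
rewrite (min_l (ltW xy)) (powR_mulB1 _ _ p a0) (powR_mulB1 _ _ p b0).
rewrite /angular_dist.
have AB : `|x| `^ (p - 1) <= `|y| `^ (p - 1).
  by apply: ge0_ler_powR; rewrite ?nnegrE ?subr_ge0 // ltW.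
have A0 := powR_ge0 `|x| (p - 1).
move: (`|x| `^ (p - 1)) (`|y| `^ (p - 1)) A0 AB => A B A0 AB.
have -> : `|x| * A + `|y| * B - (`|x| + `|y| - `|x - y|) * A
    = A * `|x - y| + (B - A) * `|y| by ring.
split; first exact: norm_scale_sub_le.
apply: weighted_slope_ge => //.
by rewrite distrC lerB_dist.
Qed.
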